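(* Let $M$ be an invariant submanifold of an $(LCS)_n$-manifold $\widetilde{M}$ with quarter symmetric metric connection, and suppose $\alpha\neq1$ (at every point). Then the second fundamental form $\sigma$ of $M$ is recurrent with respect to the quarter symmetric metric connection if and only if $M$ is totally geodesic with respect to the Levi-Civita connection.
   Context: An $(LCS)_n$-manifold (Lorentzian concircular structure manifold) is an $n$-dimensional Lorentzian manifold $(\widetilde{M},g)$, signature $(-,+,\dots,+)$, with Levi-Civita connection $\widetilde{\nabla}$, together with a unit timelike vector field $\xi$ (so $g(\xi,\xi)=-1$), the 1-form $\eta(X)=g(X,\xi)$, and a nowhere zero smooth function $\alpha$ such that $\widetilde{\nabla}_X\xi=\alpha\{X+\eta(X)\xi\}$, equivalently $(\widetilde{\nabla}_X\eta)(Y)=\alpha\{g(X,Y)+\eta(X)\eta(Y)\}$, and $X\alpha=\rho\,\eta(X)$ for all $X$, where $\rho=-(\xi\alpha)$. The structure tensor is the $(1,1)$ tensor $\phi X=\frac1\alpha\widetilde{\nabla}_X\xi=X+\eta(X)\xi$. The quarter symmetric metric connection on $\widetilde{M}$ is $\overline{\widetilde{\nabla}}_XY=\widetilde{\nabla}_XY+\eta(Y)\phi X-g(\phi X,Y)\xi$. A submanifold $M$ of dimension $m<n$ with induced metric (also denoted $g$) is invariant if $\xi$ is tangent to $M$ at every point of $M$ and $\phi(TM)\subset TM$. For $X,Y$ tangent to $M$: $\widetilde{\nabla}_XY=\nabla_XY+\sigma(X,Y)$ (tangential and normal parts), where $\sigma$ is the second fundamental form; $\overline{\nabla}_XY$ is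 the tangential part of $\overline{\widetilde{\nabla}}_XY$; and for $V$ normal, $\overline{\nabla}^\perp_XV$ is the normal part of $\overline{\widetilde{\nabla}}_XV$. $M$ is totally geodesic with respect to the Levi-Civita connection if $\sigma=0$. Covariant derivative of $\sigma$ with respect to the quarter symmetric metric connection: $(\overline{\widetilde{\nabla}}_X\sigma)(Y,Z)=\overline{\nabla}^\perp_X(\sigma(Y,Z))-\sigma(\overline{\nabla}_XY,Z)-\sigma(Y,\overline{\nabla}_XZ)$ for $X,Y,Z$ tangent to $M$. $\sigma$ is recurrent with respect to the quarter symmetric metric connection if there is a 1-form $\pi$ on $M$ with $(\overline{\widetilde{\nabla}}_X\sigma)(Y,Z)=\pi(X)\sigma(Y,Z)$ for all $X,Y,Z$ tangent to $M$. *)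

(* Defs.v *)
From mathcomp Require Import all_boot all_order all_algebra.
From mathcomp Require Import all_classical all_reals all_analysis.
Import Order.TTheory GRing.Theory Num.Theory.
Import numFieldNormedType.Exports.

Set Implicit Arguments.
Unset Strict Implicit.
Unset Printing Implicit Defensive.

Local Open Scope classical_set_scope.
Local Open Scope ring_scope.

(* Class C^k on U, for U open. *)
Fixpoint class_C {R : realType} {n : nat} {V : normedModType R} (k : nat)
    (U : set 'rV[R]_n) (f : 'rV[R]_n -> V) : Prop :=
  if k is k'.+1 then
    (forall x, U x -> differentiable f x) /\ (forall v, class_C k' U ('D_v f))
  else forall x, U x -> {for x, continuous f}.

Definition smooth_on {R : realType} {n : nat} {V : normedModType R}
    (U : set 'rV[R]_n) (f : 'rV[R]_n -> V) : Prop :=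
  forall k, class_C k U f.

(* cinv is only meaningful on cmap @` cdom, and cmap on cdom. *)
Record chart (R : realType) (n : nat) (T : topologicalType) := Chart {
  cdom : set T;
  cmap : T -> 'rV[R]_n;
  cinv : 'rV[R]_n -> T;
  cdom_open : open cdom;
  cimg_open : open (cmap @` cdom);
  cmapK : forall p, cdom p -> cinv (cmap p) = p;
  cmap_continuous : forall p, cdom p -> {for p, continuous cmap};
  cinv_continuous : forall x, (cmap @` cdom) x -> {for x, continuous cinv} }.

(* chart_at chooses, for every point, a chart of the atlas around it; the
   tangent space at p is identified with 'rV[R]_n through chart_at p. *)
Record manifold (R : realType) (n : nat) := Manifold {
  carrier :> topologicalType;
  manifold_hausdorff : hausdorff_space carrier;
  manifold_second_countable : @second_countable carrier;
  atlas : set (chart R n carrier);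
  atlas_compatible : forall c d, atlas c -> atlas d ->
    smooth_on (cmap c @` (cdom c `&` cdom d)) (cmap d \o cinv c);
  chart_at : carrier -> chart R n carrier;
  chart_at_atlas : forall p, atlas (chart_at p);
  chart_at_dom : forall p, cdom (chart_at p) p }.

Section Manifolds.
Context {R : realType} {m n : nat} {M : manifold R m} {N : manifold R n}.

Definition smooth_fun (f : M -> R) : Prop :=
  forall c, atlas c -> smooth_on (cmap c @` cdom c) (f \o cinv c).

Definition smooth_map (i : M -> N) : Prop :=
  continuous i /\
  forall (c : chart R m M) (d : chart R n N), atlas c -> atlas d ->
    smooth_on (cmap c @` (cdom c `&` i @^-1` cdom d)) (cmap d \o i \o cinv c).

(* v f, for v tangent to M at p. *)
Definition dirder (p : M) (v : 'rV[R]_m) (f : M -> R) : R :=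
  'D_v (f \o cinv (chart_at p)) (cmap (chart_at p) p).

(* The differential of i at p, from the tangent space of M at p to the tangent
   space of N at i p. *)
Definition tmap (i : M -> N) (p : M) (v : 'rV[R]_m) : 'rV[R]_n :=
  'D_v (cmap (chart_at (i p)) \o i \o cinv (chart_at p))
    (cmap (chart_at p) p).

(* The components in the chart c of the vector v tangent to M at p. *)
Definition comp_in (c : chart R m M) (p : M) (v : 'rV[R]_m) : 'rV[R]_m :=
  'D_v (cmap c \o cinv (chart_at p)) (cmap (chart_at p) p).

(* The j-th coordinate vector of the chart c at p. *)
Definition coord_vec (c : chart R m M) (j : 'I_m) (p : M) : 'rV[R]_m :=
  'D_(delta_mx 0 j) (cmap (chart_at p) \o cinv c) (cmap c p).

(* A smooth 1-form has smooth components in every chart. *)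
Definition one_form (w : M -> 'rV[R]_m -> R) : Prop :=
  (forall p a u v, w p (a *: u + v) = a * w p u + w p v) /\
  (forall (c : chart R m M) j, atlas c ->
     smooth_on (cmap c @` cdom c)
       (fun x => w (cinv c x) (coord_vec c j (cinv c x)))).

(* Signature (-,+,...,+): m orthonormal vectors in dimension m form a basis. *)
Definition lorentzian (g : M -> 'rV[R]_m -> 'rV[R]_m -> R) : Prop :=
  [/\ forall p a u v w, g p (a *: u + v) w = a * g p u w + g p v w,
      forall p u v, g p u v = g p v u,
      forall (c : chart R m M) j k, atlas c ->
        smooth_on (cmap c @` cdom c)
          (fun x => g (cinv c x) (coord_vec c j (cinv c x))
                                 (coord_vec c k (cinv c x))),
      (0 < m)%N
    & forall p, exists e : 'I_m -> 'rV[R]_m, forall j k,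
        g p (e j) (e k) =
        if j == k then (if val j == 0%N then - 1 else 1) else 0].

End Manifolds.

Section VectorFieldsAlong.
Context {R : realType} {m n : nat} {M : manifold R m} {N : manifold R n}.

(* Y is a smooth vector field along i: Y p is tangent to N at i p. *)
Definition smooth_along (i : M -> N) (Y : M -> 'rV[R]_n) : Prop :=
  forall (c : chart R m M) (d : chart R n N), atlas c -> atlas d ->
    smooth_on (cmap c @` (cdom c `&` i @^-1` cdom d))
      (fun x => comp_in d (i (cinv c x)) (Y (cinv c x))).

End VectorFieldsAlong.

Definition smooth_vf {R : realType} {n : nat} {N : manifold R n}
    (X : N -> 'rV[R]_n) : Prop :=
  smooth_along (@id N) X.

Section Connections.
Context {R : realType} {m n : nat} {M : manifold R m} {N : manifold R n}.

(* D is a connection on the pullback by i of the tangent bundle of N: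
   D p v Y is the derivative, in the direction v tangent to M at p, of the
   vector field Y along i. For i = id this is an affine connection on N. *)
Record connection_along (i : M -> N)
    (D : M -> 'rV[R]_m -> (M -> 'rV[R]_n) -> 'rV[R]_n) : Prop := {
  connection_dir : forall p a u v Y, smooth_along i Y ->
    D p (a *: u + v) Y = a *: D p u Y + D p v Y;
  connection_add : forall p v Y Z, smooth_along i Y -> smooth_along i Z ->
    D p v (fun q => Y q + Z q) = D p v Y + D p v Z;
  connection_leibniz : forall p v f Y, smooth_fun f -> smooth_along i Y ->
    D p v (fun q => f q *: Y q) = dirder p v f *: Y p + f p *: D p v Y;
  connection_smooth : forall X Y, smooth_vf X -> smooth_along i Y ->
    smooth_along i (fun p => D p (X p) Y) }.

End Connections.

(* The torsion condition is [X, Y] = nabla_X Y - nabla_Y X, as derivations. *)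
Definition levi_civita {R : realType} {n : nat} {N : manifold R n}
    (g : N -> 'rV[R]_n -> 'rV[R]_n -> R)
    (nabla : N -> 'rV[R]_n -> (N -> 'rV[R]_n) -> 'rV[R]_n) : Prop :=
  [/\ connection_along id nabla,
      forall X Y f p, smooth_vf X -> smooth_vf Y -> smooth_fun f ->
        dirder p (X p) (fun q => dirder q (Y q) f)
          - dirder p (Y p) (fun q => dirder q (X q) f)
        = dirder p (nabla p (X p) Y - nabla p (Y p) X) f
    & forall p v Y Z, smooth_vf Y -> smooth_vf Z ->
        dirder p v (fun q => g q (Y q) (Z q))
        = g p (nabla p v Y) (Z p) + g p (Y p) (nabla p v Z)].

Section LCS.
Context {R : realType} {n : nat} {N : manifold R n}.
Variables (g : N -> 'rV[R]_n -> 'rV[R]_n -> R) (xi : N -> 'rV[R]_n).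

Definition eta (p : N) (v : 'rV[R]_n) : R := g p v (xi p).

Definition phi (p : N) (v : 'rV[R]_n) : 'rV[R]_n := v + eta p v *: xi p.

Record lcs_manifold
    (nabla : N -> 'rV[R]_n -> (N -> 'rV[R]_n) -> 'rV[R]_n)
    (alpha : N -> R) : Prop := {
  lcs_lorentzian : lorentzian g;
  lcs_levi_civita : levi_civita g nabla;
  lcs_xi_smooth : smooth_vf xi;
  lcs_xi_unit : forall p, g p (xi p) (xi p) = - 1;
  lcs_alpha_smooth : smooth_fun alpha;
  lcs_alpha_neq0 : forall p, alpha p != 0;
  lcs_nabla_xi : forall p v, nabla p v xi = alpha p *: (v + eta p v *: xi p);
  lcs_dalpha : forall p v,
    dirder p v alpha = - dirder p (xi p) alpha * eta p v }.

End LCS.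

Section Submanifold.
Context {R : realType} {m n : nat} {M : manifold R m} {N : manifold R n}.

(* M is an (immersed) submanifold of N, with inclusion i. *)
Record submanifold (i : M -> N) : Prop := {
  submanifold_inj : injective i;
  submanifold_smooth : smooth_map i;
  submanifold_immersion : forall p, injective (tmap i p) }.

Variables (i : M -> N) (g : N -> 'rV[R]_n -> 'rV[R]_n -> R).

(* D is the connection induced on the vector fields along i, i.e. the pullback
   of nabla; the properties below determine it. It gives a meaning to
   nabla_X Y for X tangent to M and Y only defined on M. *)
Definition induced_connection
    (nabla : N -> 'rV[R]_n -> (N -> 'rV[R]_n) -> 'rV[R]_n)
    (D : M -> 'rV[R]_m -> (M -> 'rV[R]_n) -> 'rV[R]_n) : Prop :=
  connection_along i D /\
  forall p v Y, smooth_vf Y -> D p v (Y \o i) = nabla (i p) (tmap i p v) Y.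

(* The tangential part (as a vector tangent to M) and the normal part of the
   vector w tangent to N at i p. The tangential part exists and is unique when
   the metric induced on M is nondegenerate, in particular when a timelike
   vector field is tangent to M. *)
Definition tan_part (p : M) (w : 'rV[R]_n) : 'rV[R]_m :=
  xget 0 [set v | forall u, g (i p) (w - tmap i p v) (tmap i p u) = 0].

Definition nor_part (p : M) (w : 'rV[R]_n) : 'rV[R]_n :=
  w - tmap i p (tan_part p w).

Variable xi : N -> 'rV[R]_n.

Definition invariant_submanifold : Prop :=
  (forall p, exists v, tmap i p v = xi (i p)) /\
  (forall p v, exists u, tmap i p u = phi g xi (i p) (tmap i p v)).

Variable D : M -> 'rV[R]_m -> (M -> 'rV[R]_n) -> 'rV[R]_n.

(* X viewed as a vector field along i. *)
Definition push (X : M -> 'rV[R]_m) (p : M) : 'rV[R]_n := tmap i p (X p).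

Definition sff (X Y : M -> 'rV[R]_m) (p : M) : 'rV[R]_n :=
  nor_part p (D p (X p) (push Y)).

Definition totally_geodesic : Prop :=
  forall X Y, smooth_vf X -> smooth_vf Y -> forall p, sff X Y p = 0.

(* The quarter symmetric metric connection, on vector fields along i: for
   i = id and D the Levi-Civita connection it is the one of N, and in general
   it is the pullback of the latter. *)
Definition quarter_symmetric
    (p : M) (v : 'rV[R]_m) (Y : M -> 'rV[R]_n) : 'rV[R]_n :=
  D p v Y + eta g xi (i p) (Y p) *: phi g xi (i p) (tmap i p v)
    - g (i p) (phi g xi (i p) (tmap i p v)) (Y p) *: xi (i p).

Definition qs_tan (X Y : M -> 'rV[R]_m) (p : M) : 'rV[R]_m :=
  tan_part p (quarter_symmetric p (X p) (push Y)).

Definition qs_perp (X : M -> 'rV[R]_m) (V : M -> 'rV[R]_n) (p : M) :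
    'rV[R]_n :=
  nor_part p (quarter_symmetric p (X p) V).

Definition qs_dsff (X Y Z : M -> 'rV[R]_m) (p : M) : 'rV[R]_n :=
  qs_perp X (sff Y Z) p - sff (qs_tan X Y) Z p - sff Y (qs_tan X Z) p.

Definition qs_recurrent : Prop :=
  exists w : M -> 'rV[R]_m -> R, one_form w /\
    forall X Y Z, smooth_vf X -> smooth_vf Y -> smooth_vf Z ->
    forall p, qs_dsff X Y Z p = w p (X p) *: sff Y Z p.

End Submanifold.

(* Main.v *)
(* Write xi also for the field on M that i maps to xi. Since nabla_X xi is
   tangent to M, sigma(Y, xi) = 0, so that recurrence on the fields X, Y, xi
   says sigma(Y, nabla-bar_X xi) = 0. By invariance
   nabla-bar_X xi = (alpha - 1) phi X, and sigma(Y, phi X) = sigma(Y, X): hence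
   (alpha - 1) sigma(Y, X) = 0.
   Recurrence and total geodesy only speak of smooth fields on M, so xi and
   nabla-bar_X Y have to be shown smooth. As xi is timelike and tangent to M,
   the induced metric is nondegenerate, and the components of a tangential part
   are obtained with the inverse of the Gram matrix of the coordinate
   vectors. *)
Require Import Defs.
From mathcomp Require Import all_boot all_order all_algebra.
From mathcomp Require Import all_classical all_reals all_analysis.
From mathcomp Require Import ring.
Import Order.TTheory GRing.Theory Num.Theory.
Import numFieldNormedType.Exports.

Local Open Scope classical_set_scope.
Local Open Scope ring_scope.

(** * Functions of class C^k *)

Set Implicit Arguments.
Unset Strict Implicit.
Unset Printing Implicit Defensive.

Lemma derive_dir_linear {R : realType} {V W : normedModType R} (f : V -> W) x a
    (u v : V) : differentiable f x ->
  'D_(a *: u + v) f x = a *: 'D_u f x + 'D_v f x.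
Proof. by move=> df; rewrite !deriveE // linearP. Qed.

Lemma derive_comp {R : realType} {V W X : normedModType R} (f : V -> W)
    (h : W -> X) x v : differentiable f x -> differentiable h (f x) ->
  'D_v (h \o f) x = 'D_('D_v f x) h (f x).
Proof.
move=> df dh; rewrite (deriveE v (differentiable_comp df dh)) diff_comp //.
by rewrite (deriveE _ dh) (deriveE v df).
Qed.

Section Calculus.
Context {R : realType}.

(** Write [f = h + (f - h)]: the difference vanishes near [x], so the zero map is its differential
    there. *)
Lemma near_eq_differentiable {V W : normedModType R} (f h : V -> W) (x : V) :
  (\near x, f x = h x) -> differentiable h x -> differentiable f x.
Proof.
move=> fh dh; rewrite (_ : f = h + (f - h)); last by rewrite addrC subrK.
apply: differentiableD => //; set k := f - h.
have kx : k x = 0 by rewrite /k !fctE (nbhs_singleton fh) subrr.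
have k0 : k \o shift x = cst (k x) + (\0 : {linear V -> W}) +o_ 0 id.
  apply/eqaddoP => _/posnumP[e].
  have : \forall y \near (0 : V), f (y + x) = h (y + x).
    move: fh; rewrite (near_shift (0 : V)); apply: filterS => y /=.
    by rewrite subr0.
  apply: filterS => y fhy.
  rewrite !fctE /= kx /k !fctE /= fhy subrr !addr0 subr0 normr0.
  by rewrite mulr_ge0.
have c0 : continuous (\0 : {linear V -> W}) by move=> z; exact: cvg_cst.
by apply/diff_locallyP; rewrite (diff_unique c0 k0).
Qed.

Context {n : nat}.
Implicit Types (U : set 'rV[R]_n).

Section Codomain.
Context {V : normedModType R}.
Implicit Types (f h : 'rV[R]_n -> V).

Lemma class_C_subset k U U' f : U' `<=` U -> class_C k U f -> class_C k U' f.
Proof.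
elim: k f => [|k IH] f UU' /=; first by move=> cf x /UU'; exact: cf.
by move=> [df Df]; split=> [x /UU' /df//|v]; exact: IH.
Qed.

(** Differentiability and derivatives see only the germ at each point, and [f] and [h] have equal
    derivatives on the whole neighbourhood, which keeps the induction going. *)
Lemma class_C_local k U f :
  (forall x, U x -> exists h V, [/\ open V, V x,
     (forall y, V y -> f y = h y) & class_C k V h]) -> class_C k U f.
Proof.
elim: k f => [|k IH] f loc /=.
  move=> x /loc[h [A [oA Ax fh ch]]]; rewrite /prop_for /continuous_at.
  rewrite (fh _ Ax); have chx : h @ x --> h x := ch x Ax.
  apply: cvg_trans chx; apply: (@near_eq_cvg _ _ (nbhs x) _ h f).
  by near=> y; rewrite fh //; near: y; exact: open_nbhs_nbhs.
have nfh h (A : set 'rV[R]_n) x : open A -> A x ->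
    (forall y, A y -> f y = h y) -> \near x, f x = h x.
  by move=> oA Ax fh; apply: filterS (open_nbhs_nbhs (conj oA Ax)) => y /fh.
split=> [x /loc[h [A [oA Ax fh [dh _]]]]|v].
  by apply: near_eq_differentiable (nfh h A x oA Ax fh) _; exact: dh.
apply: IH => x /loc[h [A [oA Ax fh [_ Dh]]]].
exists ('D_v h), A; split=> //; last exact: Dh.
by move=> y Ay; exact: near_eq_derive (nfh h A y oA Ay fh).
Unshelve. all: by end_near. Qed.

(** Openness of [U] is what lets equality on [U] pass to derivatives. Chart expressions can thus be
    replaced by formulas valid only on a chart. *)
Lemma eq_class_C k U f h : open U -> (forall x, U x -> f x = h x) ->
  class_C k U h -> class_C k U f.
Proof.
by move=> oU fh ch; apply: class_C_local => x Ux; exists h, U.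
Qed.

Lemma class_CW k U f : class_C k.+1 U f -> class_C k U f.
Proof.
elim: k f => [|k IH] f [df Df].
  by move=> x Ux; exact/differentiable_continuous/df.
by split=> // v; exact: IH.
Qed.

Lemma class_C_cst k U (a : V) : class_C k U (cst a).
Proof.
elim: k a => [|k IH] a /=; first by move=> x _; exact: cst_continuous.
split=> [x _|v]; first exact: differentiable_cst.
rewrite (_ : 'D_v _ = cst 0) //; apply/funext => x; exact: derive_cst.
Qed.

Lemma class_CD k U f h : open U ->
  class_C k U f -> class_C k U h -> class_C k U (fun x => f x + h x).
Proof.
move=> oU; elim: k f h => [|k IH] f h /=.
  by move=> cf ch x Ux; apply: continuousD; [exact: cf|exact: ch].
move=> [df Df] [dh Dh]; split=> [x Ux|v].
  by apply: differentiableD; [exact: df|exact: dh].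
apply: (@eq_class_C _ _ _ (fun x => 'D_v f x + 'D_v h x)) => //; last exact: IH.
move=> x Ux; rewrite deriveD //; apply: diff_derivable.
  exact: df.
exact: dh.
Qed.

Lemma class_C_sum k U (I : Type) (r : seq I) (P : pred I)
    (f : I -> 'rV[R]_n -> V) : open U -> (forall i, P i -> class_C k U (f i)) ->
  class_C k U (fun x => \sum_(i <- r | P i) f i x).
Proof.
move=> oU cf; elim: r => [|i r IH].
  have -> : (fun x => \sum_(j <- [::] | P j) f j x) = cst 0.
    by apply/funext => x; rewrite big_nil.
  exact: class_C_cst.
have -> : (fun x => \sum_(j <- i :: r | P j) f j x) =
    fun x => if P i then f i x + \sum_(j <- r | P j) f j x
             else \sum_(j <- r | P j) f j x.
  by apply/funext => x; rewrite big_cons.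
by case Pi: (P i) => //; apply: class_CD => //; exact: cf.
Qed.

(** The case of a fixed vector comes first: it gives [class_C_row], which reduces row-valued
    functions to their coordinates, and [class_CZ] is then proved coordinatewise. *)
Lemma class_CZl k U (a : 'rV[R]_n -> R) (v : V) : open U ->
  class_C k U a -> class_C k U (fun x => a x *: v).
Proof.
move=> oU; elim: k a => [|k IH] a /=.
  move=> ca x Ux; apply: (@continuous_comp _ _ _ a ( *:%R ^~ v)).
    exact: ca.
  exact: scalel_continuous.
move=> [da Da]; split=> [x Ux|w]; first by apply: differentiableZl; exact: da.
apply: (@eq_class_C _ _ _ (fun x => 'D_w a x *: v)) => //; last exact: IH.
move=> x Ux; rewrite deriveE; last by apply: differentiableZl; exact: da.
by rewrite diffZl ?deriveE //; exact: da.
Qed.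

End Codomain.

Lemma class_C_coord k U p (f : 'rV[R]_n -> 'rV[R]_p) j : open U ->
  class_C k U f -> class_C k U (fun x => f x 0 j).
Proof.
move=> oU; elim: k f => [|k IH] f /=.
  move=> cf x Ux; apply: (@continuous_comp _ _ _ f (fun w => w 0 j)).
    exact: cf.
  exact: coord_continuous.
move=> [df Df]; split=> [x Ux|v].
  apply: (@differentiable_comp _ _ _ _ f (fun w => w 0 j)); first exact: df.
  exact: differentiable_coord.
apply: (@eq_class_C _ _ _ _ (fun x => 'D_v f x 0 j)) => //; last exact: IH.
by move=> x Ux; rewrite derive_mx ?mxE //; apply: diff_derivable; exact: df.
Qed.

Lemma class_C_row k U p (f : 'rV[R]_n -> 'rV[R]_p) : open U ->
  (forall j, class_C k U (fun x => f x 0 j)) -> class_C k U f.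
Proof.
move=> oU cf; rewrite (_ : f = fun x => \sum_j f x 0 j *: delta_mx 0 j).
  by apply: class_C_sum => // j _; exact: class_CZl.
by apply/funext => x; rewrite -row_sum_delta.
Qed.

Lemma class_CM k U (a b : 'rV[R]_n -> R) : open U ->
  class_C k U a -> class_C k U b -> class_C k U (fun x => a x * b x).
Proof.
move=> oU; elim: k a b => [|k IH] a b.
  by move=> ca cb x Ux; apply: continuousM; [exact: ca|exact: cb].
move=> ca cb; have [da Da] := ca; have [db Db] := cb.
split=> [x Ux|v].
  by apply: differentiableM; [exact: da|exact: db].
apply: (@eq_class_C _ _ _ _ (fun x => a x * 'D_v b x + b x * 'D_v a x)) => //.
  move=> x Ux; have dax : derivable a x v by exact/diff_derivable/da.
  have dbx : derivable b x v by exact/diff_derivable/db.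
  exact: deriveM.
(* In the product rule each factor also occurs undifferentiated, so its class is lowered by one to
   fit the induction hypothesis. *)
apply: class_CD => //; apply: IH; [exact: class_CW|exact: Db| |exact: Da].
exact: class_CW.
Qed.

Lemma class_CZ k U p (a : 'rV[R]_n -> R)
    (f : 'rV[R]_n -> 'rV[R]_p) : open U ->
  class_C k U a -> class_C k U f -> class_C k U (fun x => a x *: f x).
Proof.
move=> oU ca cf; apply: class_C_row => // j.
rewrite (_ : (fun x => _) = fun x => a x * f x 0 j).
  by apply: class_CM => //; exact: class_C_coord.
by apply/funext => x; rewrite mxE.
Qed.

Lemma class_C_prod k U (I : Type) (r : seq I) (P : pred I)
    (a : I -> 'rV[R]_n -> R) : open U -> (forall i, P i -> class_C k U (a i)) ->
  class_C k U (fun x => \prod_(i <- r | P i) a i x).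
Proof.
move=> oU ca; elim: r => [|i r IH].
  have -> : (fun x => \prod_(j <- [::] | P j) a j x) = cst 1.
    by apply/funext => x; rewrite big_nil.
  exact: class_C_cst.
have -> : (fun x => \prod_(j <- i :: r | P j) a j x) =
    fun x => if P i then a i x * \prod_(j <- r | P j) a j x
             else \prod_(j <- r | P j) a j x.
  by apply/funext => x; rewrite big_cons.
by case Pi: (P i) => //; apply: class_CM => //; exact: ca.
Qed.

(** By the Leibniz formula the determinant is a sum of constant signs times products of entries. *)
Lemma class_C_det k U p (A : 'rV[R]_n -> 'M[R]_p) : open U ->
  (forall a b, class_C k U (fun x => A x a b)) ->
  class_C k U (fun x => \det (A x)).
Proof.
move=> oU cA; apply: class_C_sum => // s _; apply: class_CM => //.
  exact: class_C_cst.
by apply: class_C_prod => // a _; exact: cA.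
Qed.

(** The derivative of [1/a] is [- a^-2] times that of [a]; it involves [1/a] only to an order
    covered by the induction hypothesis. *)
Lemma class_CV k U (a : 'rV[R]_n -> R) : open U ->
  (forall x, U x -> a x != 0) -> class_C k U a ->
  class_C k U (fun x => (a x)^-1).
Proof.
move=> oU a0; elim: k => [|k IH] ca.
  by move=> x Ux; apply: continuousV; [exact: a0|exact: ca].
have [da Da] := ca; split=> [x Ux|v].
  by apply: differentiableV; [exact: da|exact: a0].
apply: (@eq_class_C _ _ _ _
  (fun x => -1 * ((a x)^-1 * (a x)^-1) * 'D_v a x)) => //.
  move=> x Ux; rewrite deriveV ?a0//; last by apply: diff_derivable; exact: da.
  by rewrite mulN1r -invfM.
have cV := IH (class_CW ca).
apply: class_CM => //; last exact: Da.
by apply: class_CM => //; [exact: class_C_cst|exact: class_CM].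
Qed.

End Calculus.

(** * Chain rule and composition of C^k maps *)

Section Composition.
Context {R : realType} {n p : nat}.
Variables (U : set 'rV[R]_n) (U' : set 'rV[R]_p) (f : 'rV[R]_n -> 'rV[R]_p).
Hypotheses (oU : open U) (fU : forall x, U x -> U' (f x)).

(** [class_C] speaks of derivatives in fixed directions, while the plain chain rule yields a
    direction varying with [x]. Expanding that direction in the standard basis makes the directions
    fixed again. *)
Lemma derive_comp_coord (h : 'rV[R]_p -> R) x v :
  differentiable f x -> differentiable h (f x) ->
  'D_v (h \o f) x = \sum_j 'D_v f x 0 j * 'D_(delta_mx 0 j) h (f x).
Proof.
move=> df dh; rewrite deriveE; last exact: differentiable_comp.
rewrite diff_comp //=.
have -> : 'd f x v = \sum_j 'D_v f x 0 j *: delta_mx 0 j.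
  by rewrite -row_sum_delta deriveE.
rewrite linear_sum.
by apply: eq_bigr => j _; rewrite linearZ /= -deriveE.
Qed.

Lemma class_C_compR k (h : 'rV[R]_p -> R) :
  class_C k U f -> class_C k U' h -> class_C k U (h \o f).
Proof.
elim: k h => [|k IH] h.
  by move=> cf ch x Ux; apply: continuous_comp; [exact: cf|exact/ch/fU].
move=> cf [dh Dh]; have [df Df] := cf; split=> [x Ux|v].
  by apply: differentiable_comp; [exact: df|exact/dh/fU].
apply: (@eq_class_C _ _ _ _ _ _
  (fun x => \sum_j 'D_v f x 0 j * 'D_(delta_mx 0 j) h (f x))) => //.
  by move=> x Ux; rewrite derive_comp_coord //; [exact: df|exact/dh/fU].
apply: class_C_sum => // j _; apply: class_CM => //.
  by apply: class_C_coord => //; exact: Df.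
by apply: (IH ('D_(delta_mx 0 j) h)); [exact: class_CW|exact: Dh].
Qed.

Lemma class_C_comp k q (h : 'rV[R]_p -> 'rV[R]_q) : open U' ->
  class_C k U f -> class_C k U' h -> class_C k U (h \o f).
Proof.
move=> oU' cf ch; apply: class_C_row => // j.
by apply: (@class_C_compR k (fun y => h y 0 j)) => //; exact: class_C_coord.
Qed.

End Composition.

(** * Lorentzian forms and tangential parts *)

Lemma scalerDBB {R : pzRingType} {V : lmodType R} (a : R) (w w' t t' : V) :
  a *: w + w' - (a *: t + t') = a *: (w - t) + (w' - t').
Proof. by rewrite scalerBr opprD addrACA. Qed.

Section Forms.
Context {R : realType} {n : nat}.
Variable b : 'rV[R]_n -> 'rV[R]_n -> R.
Hypothesis bl : forall a u v w, b (a *: u + v) w = a * b u w + b v w.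
Hypothesis bC : forall u v, b u v = b v u.

Lemma bil0l w : b 0 w = 0.
Proof. by have := bl (- 1) 0 0 w; rewrite scaler0 add0r mulN1r addNr. Qed.

Lemma bilDl u v w : b (u + v) w = b u w + b v w.
Proof. by rewrite -[u]scale1r bl mul1r scale1r. Qed.

Lemma bilZl a u w : b (a *: u) w = a * b u w.
Proof. by rewrite -[a *: u]addr0 bl bil0l addr0. Qed.

Lemma bilBl u v w : b (u - v) w = b u w - b v w.
Proof. by rewrite bilDl -scaleN1r bilZl mulN1r. Qed.

Lemma bil_subr0 u v w : b u w = 0 -> b v w = 0 -> b (u - v) w = 0.
Proof. by move=> bu bv; rewrite bilBl bu bv subr0. Qed.

Lemma bilBr u v w : b w (u - v) = b w u - b w v.
Proof. by rewrite bC bilBl !(bC w). Qed.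

Lemma bilZr a u w : b w (a *: u) = a * b w u.
Proof. by rewrite bC bilZl bC. Qed.

Lemma bil_comb0 a w w' t t' x : b (w - t) x = 0 -> b (w' - t') x = 0 ->
  b (a *: w + w' - (a *: t + t')) x = 0.
Proof. by move=> bw bw'; rewrite scalerDBB bl bw bw' mulr0 addr0. Qed.

Lemma bil_suml (I : finType) (a : I -> R) (u : I -> 'rV[R]_n) w :
  b (\sum_k a k *: u k) w = \sum_k a k * b (u k) w.
Proof.
apply: (big_ind2 (fun x y => b x w = y)); first exact: bil0l.
  by move=> x1 x2 y1 y2 <- <-; exact: bilDl.
by move=> k _; exact: bilZl.
Qed.

Lemma bil_sumr (I : finType) (a : I -> R) (u : I -> 'rV[R]_n) w :
  b w (\sum_k a k *: u k) = \sum_k a k * b w (u k).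
Proof. by rewrite bC bil_suml; apply: eq_bigr => k _; rewrite bC. Qed.

(* If v is null and orthogonal to z, then a v - c z, where a and c are the
   0-th coordinates of z and v, is spacelike or zero but has square - c^2. *)
Lemma lorentzian_null_orthogonal (e : 'I_n -> 'rV[R]_n) (z v : 'rV[R]_n) :
  (forall j k, b (e j) (e k) =
     if j == k then (if val j == 0%N then - 1 else 1) else 0) ->
  (0 < n)%N -> b z z = - 1 -> b v z = 0 -> b v v = 0 -> v = 0.
Proof.
move=> be n_gt0 bzz bvz bvv; pose o := Ordinal n_gt0.
pose E : 'M[R]_n := \matrix_k e k.
have mulE (a : 'rV_n) : a *m E = \sum_k a 0 k *: e k.
  by rewrite mulmx_sum_row; apply: eq_bigr => k _; rewrite rowK.
have b_e (a : 'rV_n) j : b (a *m E) (e j) = (if j == o then - 1 else 1) * a 0 j.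
  rewrite mulE bil_suml (bigD1 j) //= big1 => [|k kj].
    by rewrite addr0 be eqxx mulrC.
  by rewrite be (negbTE kj) mulr0.
(* Pairing a combination with [e j] returns its j-th coefficient up to sign, so the [n] vectors are
   independent. *)
have Eunit : E \in unitmx.
  rewrite -row_free_unit -kermx_eq0; apply/eqP/row_matrixP => l; rewrite row0.
  have /(congr1 (fun A => row l A)) := mulmx_ker E.
  rewrite row_mul row0; move: (row l _) => a aE.
  apply/rowP => j; have := b_e a j; rewrite aE bil0l mxE.
  by case: ifP => _ /esym/eqP; rewrite ?mulN1r ?mul1r ?oppr_eq0 => /eqP.
have bE (a : 'rV_n) : a 0 o = 0 -> b (a *m E) (a *m E) = \sum_j a 0 j ^+ 2.
  move=> a0; rewrite {2}mulE bil_sumr; apply: eq_bigr => j _; rewrite b_e.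
  by case: eqP => [->|_]; rewrite expr2 ?a0 ?mul0r // mul1r.
pose co (u : 'rV_n) := u *m invmx E.
have coK u : co u *m E = u by rewrite /co -mulmxA mulVmx // mulmx1.
pose u := co z 0 o *: v - co v 0 o *: z.
have u0 : co u 0 o = 0.
  by rewrite /u /co mulmxBl -!scalemxAl !mxE mulrC subrr.
have : b u u = - co v 0 o ^+ 2.
  rewrite /u !(bilBl, bilBr, bilZl, bilZr) bvv (bC z v) bvz bzz.
  by ring.
rewrite -[u]coK bE // => su.
have cv0 : co v 0 o = 0.
  apply/eqP; rewrite -sqrf_eq0 eq_le sqr_ge0 andbT -oppr_ge0 -su.
  by apply: sumr_ge0 => j _; exact: sqr_ge0.
(* Now [v] itself has no timelike coordinate, so its zero square is a sum of squares. *)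
have /eqP : \sum_j co v 0 j ^+ 2 = 0 by rewrite -bE // coK.
rewrite psumr_eq0; last by move=> j _; exact: sqr_ge0.
move=> /allP v0; rewrite -[v]coK; have -> : co v = 0; last by rewrite mul0mx.
apply/rowP => j; rewrite [RHS]mxE; apply/eqP; rewrite -sqrf_eq0.
by apply: v0; rewrite mem_index_enum.
Qed.

End Forms.

(** * Orthogonal projection through the Gram matrix *)

Section TangentialPart.
Context {R : realType} {m n : nat}.
Variable b : 'rV[R]_n -> 'rV[R]_n -> R.
Hypothesis bl : forall a u v w, b (a *: u + v) w = a * b u w + b v w.
Hypothesis bC : forall u v, b u v = b v u.
Variable T : 'rV[R]_m -> 'rV[R]_n.
Hypothesis Tl : forall a u v, T (a *: u + v) = a *: T u + T v.
Hypothesis ndeg : forall v, (forall u, b (T v) (T u) = 0) -> v = 0.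

Lemma linear_rV_sum (a : 'I_m -> R) (u : 'I_m -> 'rV[R]_m) :
  T (\sum_k a k *: u k) = \sum_k a k *: T (u k).
Proof.
have T0 : T 0 = 0.
  by have := Tl (- 1) 0 0; rewrite scaler0 add0r scaleN1r addNr.
have TD x y : T (x + y) = T x + T y by rewrite -[x]scale1r Tl !scale1r.
apply: (big_ind2 (fun x y => T x = y)) => //.
  by move=> x1 x2 y1 y2 <- <-.
by move=> k _; rewrite -[a k *: u k]addr0 Tl T0 addr0.
Qed.

Definition gram (E : 'I_m -> 'rV[R]_m) : 'M[R]_m :=
  \matrix_(k, l) b (T (E k)) (T (E l)).

Lemma gramE E k l : gram E k l = b (T (E k)) (T (E l)).
Proof. by rewrite mxE. Qed.

Variable E : 'I_m -> 'rV[R]_m.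
Hypothesis Efree : forall a : 'rV_m, \sum_k a 0 k *: E k = 0 -> a = 0.
Hypothesis Espan : forall v, exists a : 'rV_m, v = \sum_k a 0 k *: E k.

(** A row [a] in the kernel gives a combination of the [E k] whose image is orthogonal to the image
    of [T]; nondegeneracy makes the combination zero, and freeness makes [a] zero. *)
Lemma gram_unit : gram E \in unitmx.
Proof.
rewrite -row_free_unit -kermx_eq0; apply/eqP/row_matrixP => l; rewrite row0.
have /(congr1 (fun A => row l A)) := mulmx_ker (gram E).
rewrite row_mul row0; move: (row l _) => a aG.
apply: Efree; apply: ndeg => u; have [c ->] := Espan u.
rewrite !linear_rV_sum (bil_sumr bl bC) big1 // => j _.
have : (a *m gram E) 0 j = 0 by rewrite aG mxE.
rewrite (bil_suml bl) mxE; under eq_bigr do rewrite mxE.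
by move=> ->; rewrite mulr0.
Qed.

(** The row [a] solves the normal equations: its product with the Gram matrix lists the
    [b w (T (E l))]. Hence the residue is orthogonal to each [T (E l)], and these span the image. *)
Lemma tangential_part (w : 'rV[R]_n) (a : 'rV[R]_m) :
  a = (\row_l b w (T (E l))) *m invmx (gram E) ->
  forall u, b (w - T (\sum_k a 0 k *: E k)) (T u) = 0.
Proof.
move=> ea u; have [c ->] := Espan u.
rewrite [T (\sum_k c 0 k *: _)]linear_rV_sum (bil_sumr bl bC).
rewrite big1 // => j _; have : (a *m gram E) 0 j = b w (T (E j)).
  by rewrite ea mulmxKV ?gram_unit // mxE.
rewrite mxE; under eq_bigr do rewrite mxE.
by rewrite (bilBl bl) linear_rV_sum (bil_suml bl) => ->; rewrite subrr mulr0.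
Qed.

End TangentialPart.

(** * Charts *)

(** This turns facts about one manifold, such as changes of charts, into instances of facts about
    smooth maps. *)
Lemma smooth_id {R : realType} {n : nat} (N : manifold R n) :
  smooth_map (@id N).
Proof.
by split=> [|c d]; [move=> p; exact: cvg_id|exact: atlas_compatible].
Qed.

Section Charts.
Context {R : realType} {m n : nat} {M : manifold R m} {N : manifold R n}.

(** Inside the open image of the chart, the set is the preimage of [A] under the continuous
    [cinv c]. *)
Lemma chart_image_open (c : chart R m M) (A : set M) :
  open A -> open (cmap c @` (cdom c `&` A)).
Proof.
move=> oA; rewrite openE => _ [p [cp Ap] <-]; rewrite /interior.
have cx : (cmap c @` cdom c) (cmap c p) by exists p.
have := cinv_continuous cx; rewrite /prop_for /continuous_at cmapK // => cc.
have nA : nbhs (cmap c p) (cinv c @^-1` A).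
  exact: cc _ (open_nbhs_nbhs (conj oA Ap)).
have nc := open_nbhs_nbhs (conj (cimg_open (c := c)) cx).
apply: filterS2 nA nc => _ /[swap] -[q cq <-] /= Ay.
by exists q => //; split=> //; move: Ay; rewrite cmapK.
Qed.

(** Coordinates near [cmap c p] come from points of the chart domain, where [cmapK] applies; this
    justifies simplifying a map under a derivative. *)
Lemma near_chart (c : chart R m M) (A : set M) p : open A -> cdom c p -> A p ->
  \forall y \near cmap c p, exists q, [/\ cdom c q, A q & y = cmap c q].
Proof.
move=> oA cp Ap.
have h : (cmap c @` (cdom c `&` A)) (cmap c p) by exists p.
have := open_nbhs_nbhs (conj (chart_image_open (c := c) oA) h).
by apply: filterS => _ [q [cq Aq] <-]; exists q.
Qed.

Variable i : M -> N.
Hypothesis si : smooth_map i.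

(** The coordinate expression of [i], meaningful on the set [overlap c d] below. *)
Definition rep (c : chart R m M) (d : chart R n N) := cmap d \o i \o cinv c.

Definition overlap (c : chart R m M) (d : chart R n N) :=
  cmap c @` (cdom c `&` i @^-1` cdom d).

Lemma preim_cdom_open (d : chart R n N) : open (i @^-1` cdom d).
Proof. have [ci _] := si; exact: (continuousP _).1 ci _ (cdom_open d). Qed.

Lemma overlap_open c d : open (overlap c d).
Proof. exact/chart_image_open/preim_cdom_open. Qed.

Lemma rep_smooth c d : atlas c -> atlas d -> smooth_on (overlap c d) (rep c d).
Proof. by have [_] := si; apply. Qed.

Lemma rep_differentiable c d p : atlas c -> atlas d -> cdom c p ->
  cdom d (i p) -> differentiable (rep c d) (cmap c p).
Proof.
move=> ac ad cp dp; have [+ _] := rep_smooth ac ad 1.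
by apply; exists p.
Qed.

Lemma rep_in c d x : overlap c d x -> (cmap d @` cdom d) (rep c d x).
Proof. by case=> p [cp dp] <-; exists (i p); rewrite // /rep /= cmapK. Qed.

Lemma repE c d p : cdom c p -> rep c d (cmap c p) = cmap d (i p).
Proof. by move=> cp; rewrite /rep /= cmapK. Qed.

End Charts.
Arguments overlap_open {R m n M N i} si c d.
Arguments rep_in {R m n M N} i c d x.

(** * Changes of charts in source and target *)

Section ChangeOfCharts.
Context {R : realType} {m n : nat} {M : manifold R m} {N : manifold R n}.
Variable i : M -> N.
Hypothesis si : smooth_map i.
Variable p : M.

(** Chain rule through a second chart of the target. The composite equals [rep i e d] only near the
    point, which is all that a derivative sees. *)
Lemma rep_target (e : chart R m M) (d d' : chart R n N) v :
  atlas e -> atlas d -> atlas d' -> cdom e p -> cdom d (i p) -> cdom d' (i p) ->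
  'D_('D_v (rep i e d') (cmap e p)) (cmap d \o cinv d') (cmap d' (i p)) =
  'D_v (rep i e d) (cmap e p).
Proof.
move=> ae ad ad' ep dp d'p.
rewrite -(repE i d' ep) -derive_comp; last 2 first.
- exact: rep_differentiable.
- by rewrite repE //; exact: (rep_differentiable (@smooth_id _ _ N)).
apply: near_eq_derive.
have := near_chart (preim_cdom_open si d') ep d'p.
apply: filterS => _ [q [eq d'q ->]].
by rewrite /rep /= cmapK // cmapK.
Qed.

Lemma rep_source (c e : chart R m M) (d : chart R n N) v :
  atlas c -> atlas e -> atlas d -> cdom c p -> cdom e p -> cdom d (i p) ->
  'D_('D_v (cmap c \o cinv e) (cmap e p)) (rep i c d) (cmap c p) =
  'D_v (rep i e d) (cmap e p).
Proof.
move=> ac ae ad cp ep dp.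
have ce : (cmap c \o cinv e) (cmap e p) = cmap c p by rewrite /= cmapK.
rewrite -[X in derive _ X _]ce -derive_comp; last 2 first.
- exact: (rep_differentiable (@smooth_id _ _ M)).
- by rewrite ce; exact: rep_differentiable.
apply: near_eq_derive.
have := near_chart (cdom_open c) ep cp.
apply: filterS => _ [q [eq cq ->]].
by rewrite /rep /= !cmapK.
Qed.

End ChangeOfCharts.

(** * Components of tangent vectors and of the differential *)

Section Components.
Context {R : realType} {m n : nat} {M : manifold R m} {N : manifold R n}.

Lemma derive_chart_id (c : chart R m M) p v : cdom c p ->
  'D_v (cmap c \o cinv c) (cmap c p) = v.
Proof.
move=> cp; rewrite -[RHS](derive_id (cmap c p)); apply: near_eq_derive.
have := near_chart (cdom_open c) cp cp.
by apply: filterS => _ [q [cq _ ->]]; rewrite /= cmapK.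
Qed.

Lemma comp_in_linear (c : chart R m M) p a u v : atlas c -> cdom c p ->
  comp_in c p (a *: u + v) = a *: comp_in c p u + comp_in c p v.
Proof.
move=> ac cp; apply: derive_dir_linear.
exact: (rep_differentiable (@smooth_id _ _ M) (chart_at_atlas p) ac
  (chart_at_dom p) cp).
Qed.

Lemma comp_inD (c : chart R m M) p u v : atlas c -> cdom c p ->
  comp_in c p (u + v) = comp_in c p u + comp_in c p v.
Proof.
by move=> ac cp; have := comp_in_linear 1 u v ac cp; rewrite !scale1r.
Qed.

Lemma comp_inZ (c : chart R m M) p a v : atlas c -> cdom c p ->
  comp_in c p (a *: v) = a *: comp_in c p v.
Proof.
move=> ac cp; have c0 := comp_in_linear (- 1) 0 0 ac cp.
rewrite scaler0 add0r scaleN1r addNr in c0.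
by have := comp_in_linear a v 0 ac cp; rewrite addr0 c0 addr0.
Qed.

Lemma comp_in_coord_vec (c : chart R m M) k p : atlas c -> cdom c p ->
  comp_in c p (coord_vec c k p) = delta_mx 0 k.
Proof.
move=> ac cp.
rewrite /comp_in /coord_vec (rep_target (@smooth_id _ _ M)) //.
- exact: derive_chart_id.
- exact: chart_at_atlas.
- exact: chart_at_dom.
Qed.

(** The differential of the transition from [c] back to [chart_at p] undoes [comp_in c p]; by
    linearity it sends the standard expansion of the components to that of [v]. *)
Lemma coord_vec_comp_in (c : chart R m M) p v : atlas c -> cdom c p ->
  v = \sum_k comp_in c p v 0 k *: coord_vec c k p.
Proof.
move=> ac cp; have ae := chart_at_atlas p; have ep := chart_at_dom p.
have df := rep_differentiable (@smooth_id _ _ M) ac ae cp ep.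
transitivity ('D_(comp_in c p v) (rep id c (chart_at p)) (cmap c p)).
  by rewrite (rep_source (@smooth_id _ _ M)) // derive_chart_id.
rewrite {1}[comp_in c p v]row_sum_delta deriveE // linear_sum.
by apply: eq_bigr => k _; rewrite linearZ /= -deriveE.
Qed.

Variable i : M -> N.
Hypothesis si : smooth_map i.

Lemma tmap_linear p a u v :
  tmap i p (a *: u + v) = a *: tmap i p u + tmap i p v.
Proof.
apply: derive_dir_linear; apply: rep_differentiable => //;
  exact: chart_at_atlas || exact: chart_at_dom.
Qed.

(** Frees [tmap] from the chosen charts [chart_at]: any two charts may be used to compute it. *)
Lemma comp_in_tmap (c : chart R m M) (d : chart R n N) p v :
  atlas c -> atlas d -> cdom c p -> cdom d (i p) ->
  comp_in d (i p) (tmap i p v) = 'D_(comp_in c p v) (rep i c d) (cmap c p).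
Proof.
move=> ac ad cp dp; have ae := chart_at_atlas p; have ep := chart_at_dom p.
have ae' := chart_at_atlas (i p); have e'p := chart_at_dom (i p).
by rewrite [LHS](rep_target si) // rep_source.
Qed.

End Components.

Lemma tmap_id {R : realType} {n : nat} (N : manifold R n) (p : N) v :
  tmap id p v = v.
Proof. exact: (derive_chart_id (c := chart_at p) _ (chart_at_dom p)). Qed.

(** * Smooth fields along a map *)

Section SmoothAlong.
Context {R : realType} {m n : nat} {M : manifold R m} {N : manifold R n}.
Variable i : M -> N.
Hypothesis si : smooth_map i.
Implicit Types (c : chart R m M) (d : chart R n N) (Y Z : M -> 'rV[R]_n).

Lemma overlap_sub c d : overlap i c d `<=` cmap c @` cdom c.
Proof. by move=> _ [p [cp _] <-]; exists p. Qed.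

Lemma overlap_chart_at c p : cdom c p ->
  overlap i c (chart_at (i p)) (cmap c p).
Proof. by move=> cp; exists p => //; split => //; exact: chart_at_dom. Qed.

(** The overlaps with the charts of [N] are open and cover the image of [c], and smoothness is
    local. *)
Lemma smooth_on_overlaps {V : normedModType R} c (f : 'rV[R]_m -> V) :
  (forall d, atlas d -> smooth_on (overlap i c d) f) ->
  smooth_on (cmap c @` cdom c) f.
Proof.
move=> sf k; apply: class_C_local => _ [p cp <-].
exists f, (overlap i c (chart_at (i p))); split=> //.
- exact: overlap_open.
- exact: overlap_chart_at.
- exact/sf/chart_at_atlas.
Qed.

Lemma smooth_fun_overlap (f : M -> R) c d : smooth_fun f -> atlas c ->
  smooth_on (overlap i c d) (f \o cinv c).
Proof.
by move=> sf ac k; apply: class_C_subset (sf c ac k); exact: overlap_sub.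
Qed.

Lemma smooth_alongD Y Z : smooth_along i Y -> smooth_along i Z ->
  smooth_along i (fun p => Y p + Z p).
Proof.
move=> sY sZ c d ac ad k; have oU := overlap_open si c d.
apply: eq_class_C (class_CD oU (sY c d ac ad k) (sZ c d ac ad k)) => //.
move=> _ [p [cp dp] <-]; rewrite !cmapK //.
exact: comp_inD.
Qed.

Lemma smooth_alongZ (f : M -> R) Y : smooth_fun f -> smooth_along i Y ->
  smooth_along i (fun p => f p *: Y p).
Proof.
move=> sf sY c d ac ad k; have oU := overlap_open si c d.
have cf := smooth_fun_overlap d sf ac k.
apply: eq_class_C (class_CZ oU cf (sY c d ac ad k)) => // _ [p [cp dp] <-].
rewrite /= !cmapK //; exact: comp_inZ.
Qed.

(** In charts the components get multiplied by the Jacobian of [rep i c d]. Working on a single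
    overlap allows [v] to be a coordinate field of [c], which makes sense only on that chart. *)
Lemma smooth_along_tmap c d (v : M -> 'rV[R]_m) :
  atlas c -> atlas d ->
  smooth_on (overlap i c d) (fun x => comp_in c (cinv c x) (v (cinv c x))) ->
  smooth_on (overlap i c d)
    (fun x => comp_in d (i (cinv c x)) (tmap i (cinv c x) (v (cinv c x)))).
Proof.
move=> ac ad sv k; have oU := overlap_open si c d.
apply: (@eq_class_C _ _ _ _ _ _ (fun x => \sum_j
  comp_in c (cinv c x) (v (cinv c x)) 0 j *: 'D_(delta_mx 0 j) (rep i c d) x)).
- by [].
- move=> _ [p [cp dp] <-]; rewrite !cmapK // (comp_in_tmap si _ ac ad)//.
  have df := rep_differentiable si ac ad cp dp.
  rewrite {1}[comp_in c p _]row_sum_delta deriveE // linear_sum.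
  by apply: eq_bigr => j _; rewrite linearZ /= -deriveE.
- apply: class_C_sum => // j _; apply: class_CZ => //.
    exact: class_C_coord.
  (* The Jacobian is of class C^k because the map is of class C^(k+1). *)
  by have [_] := rep_smooth si ac ad k.+1; apply.
Qed.

Lemma smooth_along_push (X : M -> 'rV[R]_m) :
  (forall c, atlas c -> smooth_on (cmap c @` cdom c)
    (fun x => comp_in c (cinv c x) (X (cinv c x)))) ->
  smooth_along i (push i X).
Proof.
move=> sX c d ac ad; apply: smooth_along_tmap => // k.
by apply: class_C_subset (sX c ac k); exact: overlap_sub.
Qed.

Lemma smooth_vf_comp_in (X : M -> 'rV[R]_m) c : smooth_vf X -> atlas c ->
  smooth_on (cmap c @` cdom c) (fun x => comp_in c (cinv c x) (X (cinv c x))).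
Proof.
move=> sX ac k; apply: class_C_subset (sX c c ac ac k) => _ [p cp <-].
by exists p.
Qed.

Lemma smooth_fun_comp (f : N -> R) : smooth_fun f -> smooth_fun (f \o i).
Proof.
move=> sf c ac; apply: smooth_on_overlaps => d ad k.
have oU := overlap_open si c d.
apply: eq_class_C (class_C_compR oU (rep_in i c d)
  (rep_smooth si ac ad k) (sf d ad k)) => // _ [p [cp dp] <-].
by rewrite /rep /= !cmapK.
Qed.

Lemma smooth_along_comp (Y : N -> 'rV[R]_n) :
  smooth_vf Y -> smooth_along i (Y \o i).
Proof.
move=> sY c d ac ad k; have oU := overlap_open si c d.
have sYd : class_C k (cmap d @` cdom d)
    (fun y => comp_in d (cinv d y) (Y (cinv d y))).
  apply: class_C_subset (sY d d ad ad k) => _ [p dp <-].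
  by exists p.
apply: eq_class_C (class_C_comp oU (rep_in i c d) (cimg_open (c := d))
  (rep_smooth si ac ad k) sYd) => // _ [p [cp dp] <-].
by rewrite /rep /= !cmapK.
Qed.

Variable g : N -> 'rV[R]_n -> 'rV[R]_n -> R.
Hypothesis gL : lorentzian g.

(** Both fields are expanded in the coordinate vectors of [d]; the coefficients [G a b] of the
    metric are smooth on [N] and are composed with [rep i c d]. *)
Lemma smooth_metric_overlap c d Y Z : atlas c -> atlas d ->
  smooth_on (overlap i c d)
    (fun x => comp_in d (i (cinv c x)) (Y (cinv c x))) ->
  smooth_on (overlap i c d)
    (fun x => comp_in d (i (cinv c x)) (Z (cinv c x))) ->
  smooth_on (overlap i c d)
    (fun x => g (i (cinv c x)) (Y (cinv c x)) (Z (cinv c x))).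
Proof.
move=> ac ad sY sZ k; have oU := overlap_open si c d.
have [gl gC gs _ _] := gL.
pose G a b y := g (cinv d y) (coord_vec d a (cinv d y))
                  (coord_vec d b (cinv d y)).
apply: (@eq_class_C _ _ _ _ _ _ (fun x => \sum_a \sum_b
  comp_in d (i (cinv c x)) (Y (cinv c x)) 0 a *
  (comp_in d (i (cinv c x)) (Z (cinv c x)) 0 b * (G a b \o rep i c d) x))).
- by [].
- move=> _ [p [cp dp] <-]; rewrite /= repE // /G !cmapK //.
  rewrite {1}(coord_vec_comp_in (Y p) ad dp) (bil_suml (gl (i p))).
  apply: eq_bigr => a _; rewrite -mulr_sumr; congr (_ * _).
  by rewrite {1}(coord_vec_comp_in (Z p) ad dp) (bil_sumr (gl _) (gC _)).
- apply: class_C_sum => // a _; apply: class_C_sum => // b _.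
  apply: class_CM => //; first exact: class_C_coord.
  apply: class_CM => //; first exact: class_C_coord.
  apply: class_C_compR (rep_smooth si ac ad k) (gs d a b ad k) => //.
  exact: rep_in.
Qed.

Lemma smooth_metric Y Z : smooth_along i Y -> smooth_along i Z ->
  smooth_fun (fun p => g (i p) (Y p) (Z p)).
Proof.
move=> sY sZ c ac; apply: smooth_on_overlaps => d ad.
by apply: smooth_metric_overlap => //; [exact: sY|exact: sZ].
Qed.

End SmoothAlong.

Lemma push_id {R : realType} {n : nat} (N : manifold R n) (X : N -> 'rV[R]_n) :
  push id X = X.
Proof. by apply/funext => p; exact: tmap_id. Qed.

(** * Tangential parts when some tangent vector is timelike *)

Section TanPart.
Context {R : realType} {m n : nat} {M : manifold R m} {N : manifold R n}.
Variables (i : M -> N) (g : N -> 'rV[R]_n -> 'rV[R]_n -> R).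
Hypothesis si : smooth_map i.
Hypothesis immersion : forall p, injective (tmap i p).
Hypothesis gL : lorentzian g.
Hypothesis timelike :
  forall p, exists v, g (i p) (tmap i p v) (tmap i p v) = - 1.

Let gl p := let: And5 h _ _ _ _ := gL in h p.
Let gC p := let: And5 _ h _ _ _ := gL in h p.
Let Tl p a u v := tmap_linear si p a u v.

Lemma tmap0 p : tmap i p 0 = 0.
Proof. by have := Tl p (- 1) 0 0; rewrite scaler0 add0r scaleN1r addNr. Qed.

(** The image of such a [v] is null and orthogonal to a timelike tangent vector, hence zero; the
    immersion property then gives [v = 0]. *)
Lemma induced_nondegenerate p v :
  (forall u, g (i p) (tmap i p v) (tmap i p u) = 0) -> v = 0.
Proof.
move=> gv; have [z gz] := timelike p.
have [_ _ _ n_gt0 /(_ (i p))[e ge]] := gL.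
apply: (immersion (p := p)); rewrite tmap0.
exact: (lorentzian_null_orthogonal (gl _) (gC _) ge n_gt0 gz).
Qed.

Let frame_gram p (E : 'I_m -> 'rV[R]_m) := gram (g (i p)) (tmap i p) E.

(** Two candidates for the choice made by [xget] differ by a vector orthogonal to the whole tangent
    space. *)
Lemma tan_part_eq p w v :
  (forall u, g (i p) (w - tmap i p v) (tmap i p u) = 0) -> tan_part i g p w = v.
Proof.
move=> wv; apply: xget_unique => // v' wv'; apply/eqP; rewrite -subr_eq0.
apply/eqP; apply: (@induced_nondegenerate p) => u.
have -> : tmap i p (v' - v) = (w - tmap i p v) - (w - tmap i p v').
  rewrite [RHS]addrC opprB subrKA [v' - v]addrC -scaleN1r Tl scaleN1r.
  by rewrite addrC.
exact: (bil_subr0 (gl (i p)) (wv u) (wv' u)).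
Qed.

Lemma tan_partP p w u :
  g (i p) (w - tmap i p (tan_part i g p w)) (tmap i p u) = 0.
Proof.
(* Existence at a single point can use any frame; the standard basis is the simplest. *)
pose E k : 'rV[R]_m := delta_mx 0 k.
have Efree (a : 'rV[R]_m) : \sum_k a 0 k *: E k = 0 -> a = 0.
  by rewrite -row_sum_delta.
have Espan (v : 'rV[R]_m) : exists a : 'rV[R]_m, v = \sum_k a 0 k *: E k.
  by exists v; rewrite -row_sum_delta.
have h := tangential_part (gl _) (gC _) (Tl p) (@induced_nondegenerate p)
  Efree Espan (w := w) erefl.
by rewrite (tan_part_eq h); exact: h.
Qed.

Lemma tan_part_tmap p v : tan_part i g p (tmap i p v) = v.
Proof. by apply: tan_part_eq => u; rewrite subrr (bil0l (gl _)). Qed.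

Lemma tan_part_linear p a (w w' : 'rV[R]_n) : tan_part i g p (a *: w + w') =
  a *: tan_part i g p w + tan_part i g p w'.
Proof.
apply: tan_part_eq => u; rewrite Tl.
by apply: (bil_comb0 (gl _)); exact: tan_partP.
Qed.

Lemma nor_part_tmap p v : nor_part i g p (tmap i p v) = 0.
Proof. by rewrite /nor_part tan_part_tmap subrr. Qed.

Lemma nor_part0 p : nor_part i g p 0 = 0.
Proof. by have := nor_part_tmap p 0; rewrite tmap0. Qed.

Lemma nor_part_linear p a (w w' : 'rV[R]_n) : nor_part i g p (a *: w + w') =
  a *: nor_part i g p w + nor_part i g p w'.
Proof. by rewrite /nor_part tan_part_linear Tl scalerDBB. Qed.

Lemma coord_vec_free (c : chart R m M) p (a : 'rV[R]_m) : atlas c -> cdom c p ->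
  \sum_k a 0 k *: coord_vec c k p = 0 -> a = 0.
Proof.
move=> ac cp a0; have := congr1 (comp_in c p) a0.
rewrite (linear_rV_sum (fun b u v => comp_in_linear b u v ac cp)).
under eq_bigr do rewrite comp_in_coord_vec //.
rewrite -row_sum_delta => ->.
by rewrite -[X in comp_in c p X](scale0r 0) comp_inZ // scale0r.
Qed.

Lemma coord_vec_span (c : chart R m M) p v : atlas c -> cdom c p ->
  exists a : 'rV[R]_m, v = \sum_k a 0 k *: coord_vec c k p.
Proof. by move=> ac cp; exists (comp_in c p v); exact: coord_vec_comp_in. Qed.

(** Here the frame is that of a chart, so that every ingredient of the formula varies smoothly with
    [p]. *)
Lemma comp_in_tan_part (c : chart R m M) p w : atlas c -> cdom c p ->
  comp_in c p (tan_part i g p w) =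
  (\row_l g (i p) w (tmap i p (coord_vec c l p))) *m
    invmx (frame_gram p (fun k => coord_vec c k p)).
Proof.
move=> ac cp; set a := RHS.
have h := tangential_part (gl _) (gC _) (Tl p) (@induced_nondegenerate p)
  (fun a => coord_vec_free ac cp) (fun v => coord_vec_span v ac cp)
  (w := w) (erefl a).
rewrite (tan_part_eq h).
rewrite (linear_rV_sum (fun b u v => comp_in_linear b u v ac cp)).
under eq_bigr do rewrite comp_in_coord_vec //.
by rewrite -row_sum_delta.
Qed.

Lemma smooth_tan_part (W : M -> 'rV[R]_n) : smooth_along i W ->
  smooth_vf (fun p => tan_part i g p (W p)).
Proof.
(* Seen as a push-forward by the identity, the field need only be checked within one chart [c] at a
   time. *)
move=> sW; rewrite -[fun p => _]push_id.
apply: (smooth_along_push (@smooth_id _ _ M)) => c ac.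
apply: (smooth_on_overlaps si) => d ad k.
have oU := overlap_open si c d.
pose T l p := tmap i p (coord_vec c l p).
have sT l : smooth_on (overlap i c d)
    (fun x => comp_in d (i (cinv c x)) (T l (cinv c x))).
  apply: (smooth_along_tmap si (v := coord_vec c l)) => // k'.
  apply: eq_class_C (class_C_cst _ _ (delta_mx 0 l)) => // _ [p [cp dp] <-].
  by rewrite cmapK // comp_in_coord_vec.
pose G x := frame_gram (cinv c x) (fun l => coord_vec c l (cinv c x)).
have cG a b : class_C k (overlap i c d) (fun x => G x a b).
  rewrite (_ : (fun x => _) = fun x =>
      g (i (cinv c x)) (T a (cinv c x)) (T b (cinv c x))).
    exact: (smooth_metric_overlap si gL ac ad (sT a) (sT b) k).
  by apply/funext => x; exact: gramE.
have dom x : overlap i c d x -> cdom c (cinv c x).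
  by move=> [p [cp _] <-]; rewrite cmapK.
have Gu x : overlap i c d x -> G x \in unitmx.
  move=> /dom cq.
  exact: (gram_unit (gl _) (gC _) (Tl _) (@induced_nondegenerate _)
    (fun a => coord_vec_free ac cq) (fun v => coord_vec_span v ac cq)).
(* Cramer's rule: the inverse Gram matrix is written with cofactors and the determinant, which are
   polynomial in smooth entries. *)
pose B j x := \sum_l g (i (cinv c x)) (W (cinv c x)) (T l (cinv c x)) *
  ((\det (G x))^-1 * cofactor (G x) j l).
apply: (@eq_class_C _ _ _ _ _ _ (fun x => \row_j B j x)) => //.
  move=> x Ux; rewrite (comp_in_tan_part _ ac (dom x Ux)) -/(G x).
  apply/rowP => j; rewrite !mxE; apply: eq_bigr => l _.
  by rewrite mxE; congr (_ * _); rewrite /invmx Gu // !mxE.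
apply: class_C_row => // j.
rewrite (_ : (fun x => _) = B j); last by apply/funext => x; rewrite mxE.
apply: class_C_sum => // l _; apply: class_CM => //.
  exact: (smooth_metric_overlap si gL ac ad (sW c d ac ad) (sT l) k).
apply: class_CM => //.
  apply: class_CV => //; last exact: class_C_det.
  by move=> x /Gu; rewrite unitmxE unitfE.
apply: class_CM => //; first exact: class_C_cst.
apply: class_C_det => // a b.
have minorE (A : 'M[R]_m) : row' j (col' l A) a b = A (lift j a) (lift l b).
  by rewrite !mxE.
rewrite (_ : (fun x => _) = fun x => G x (lift j a) (lift l b)) //.
by apply/funext => x; exact: minorE.
Qed.

End TanPart.

(** * Invariant submanifolds *)

Section SmoothFunctions.
Context {R : realType} {m : nat} {M : manifold R m}.

Lemma smooth_fun_cst (a : R) : smooth_fun (fun _ : M => a).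
Proof. by move=> c ac k; exact: class_C_cst. Qed.

Lemma smooth_funD (f h : M -> R) : smooth_fun f -> smooth_fun h ->
  smooth_fun (fun p => f p + h p).
Proof.
move=> sf sh c ac k.
exact: (class_CD (cimg_open (c := c)) (sf c ac k) (sh c ac k)).
Qed.

End SmoothFunctions.

Section InvariantSubmanifold.
Context {R : realType} {m n : nat} {M : manifold R m} {N : manifold R n}.
Variables (g : N -> 'rV[R]_n -> 'rV[R]_n -> R)
  (nabla : N -> 'rV[R]_n -> (N -> 'rV[R]_n) -> 'rV[R]_n)
  (xi : N -> 'rV[R]_n) (alpha : N -> R).
Hypothesis hN : lcs_manifold g xi nabla alpha.
Variable i : M -> N.
Hypotheses (hi : submanifold i) (hinv : invariant_submanifold i g xi).
Variable D : M -> 'rV[R]_m -> (M -> 'rV[R]_n) -> 'rV[R]_n.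
Hypothesis hD : induced_connection i nabla D.

Let si : smooth_map i := submanifold_smooth hi.
Let immersion p : injective (tmap i p) := submanifold_immersion hi (p := p).
Let gL : lorentzian g := lcs_lorentzian hN.
Let Dconn : connection_along i D := hD.1.

Lemma invariant_timelike p :
  exists v, g (i p) (tmap i p v) (tmap i p v) = - 1.
Proof. by have [v vxi] := hinv.1 p; exists v; rewrite vxi (lcs_xi_unit hN). Qed.

Let timelike := invariant_timelike.
Let gl p := let: And5 h _ _ _ _ := gL in h p.
Let gC p := let: And5 _ h _ _ _ := gL in h p.

Lemma nor_partD p (w w' : 'rV[R]_n) :
  nor_part i g p (w + w') = nor_part i g p w + nor_part i g p w'.
Proof.
have := nor_part_linear si immersion gL timelike p 1 w w'.
by rewrite !scale1r.
Qed.

Lemma nor_partZ p a (w : 'rV[R]_n) :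
  nor_part i g p (a *: w) = a *: nor_part i g p w.
Proof.
have := nor_part_linear si immersion gL timelike p a w 0.
by rewrite (nor_part0 si immersion gL timelike) !addr0.
Qed.

Lemma nor_part_tangent p w : (exists u, tmap i p u = w) -> nor_part i g p w = 0.
Proof. by move=> [u <-]; exact: nor_part_tmap. Qed.

Lemma tmap_tan_part p w : (exists u, tmap i p u = w) ->
  tmap i p (tan_part i g p w) = w.
Proof. by move=> [u <-]; rewrite (tan_part_tmap si immersion gL timelike). Qed.

Lemma nor_part_xi p : nor_part i g p (xi (i p)) = 0.
Proof. exact/nor_part_tangent/hinv.1. Qed.

Lemma nor_part_phi p v : nor_part i g p (phi g xi (i p) (tmap i p v)) = 0.
Proof. exact/nor_part_tangent/hinv.2. Qed.

Lemma smooth_along_xi : smooth_along i (xi \o i).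
Proof. exact: (smooth_along_comp si (lcs_xi_smooth hN)). Qed.

Lemma smooth_push X : smooth_vf X -> smooth_along i (push i X).
Proof.
by move=> sX; apply: (smooth_along_push si) => c; exact: smooth_vf_comp_in.
Qed.

Lemma smooth_eta Y : smooth_along i Y ->
  smooth_fun (fun p => eta g xi (i p) (Y p)).
Proof. by move=> sY; exact: (smooth_metric si gL sY smooth_along_xi). Qed.

Lemma smooth_eta_xi Y : smooth_along i Y ->
  smooth_along i (fun p => eta g xi (i p) (Y p) *: xi (i p)).
Proof.
by move=> sY; exact: (smooth_alongZ si (smooth_eta sY) smooth_along_xi).
Qed.

Lemma smooth_phi Y : smooth_along i Y ->
  smooth_along i (fun p => phi g xi (i p) (Y p)).
Proof. by move=> sY; exact: (smooth_alongD si sY (smooth_eta_xi sY)). Qed.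

Lemma smooth_quarter_symmetric X Y : smooth_vf X -> smooth_along i Y ->
  smooth_along i (fun p => quarter_symmetric i g xi D p (X p) Y).
Proof.
move=> sX sY; have sp := smooth_phi (smooth_push sX).
have sg := smooth_alongZ si (smooth_metric si gL sp sY) smooth_along_xi.
(* The subtracted term is treated as an added multiple by the constant function [-1]. *)
have sN := smooth_alongZ si (smooth_fun_cst (- 1)) sg.
have sD := smooth_alongD si (connection_smooth Dconn sX sY)
  (smooth_alongZ si (smooth_eta sY) sp).
have := smooth_alongD si sD sN; congr smooth_along; apply/funext => p.
by rewrite scaleN1r.
Qed.

Lemma smooth_qs_tan X Y : smooth_vf X -> smooth_vf Y ->
  smooth_vf (qs_tan i g xi D X Y).
Proof.
move=> sX sY; apply: (smooth_tan_part si immersion gL timelike).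
exact: (smooth_quarter_symmetric sX (smooth_push sY)).
Qed.

(** Along [i], the field [xi \o i] is the restriction of a field of [N], so [D] is computed there by
    [nabla]. *)
Lemma connection_xi p v :
  D p v (xi \o i) = alpha (i p) *: phi g xi (i p) (tmap i p v).
Proof. by rewrite hD.2 ?(lcs_nabla_xi hN) //; exact: lcs_xi_smooth hN. Qed.

Lemma connection0 p v : D p v (fun _ => 0) = 0.
Proof.
(* Additivity of [D] requires smooth fields; the zero field is obtained as [0 *: xi]. *)
have s0 : smooth_along i (fun _ => 0).
  have := smooth_alongZ si (smooth_fun_cst 0) smooth_along_xi.
  by congr smooth_along; apply/funext => q; rewrite scale0r.
have := connection_add Dconn p v s0 s0.
rewrite (_ : (fun _ => 0 + 0) = fun=> 0); last first.
  by apply/funext => q; rewrite addr0.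
by move=> /eqP; rewrite -subr_eq0 opprD addrA subrr add0r oppr_eq0 => /eqP.
Qed.

(** Removes the first term of [qs_dsff] wherever sigma vanishes identically, as needed in both
    directions of the equivalence. *)
Lemma qs_perp0 X p : qs_perp i g xi D X (fun _ => 0) p = 0.
Proof.
rewrite /qs_perp /quarter_symmetric connection0 /eta (bil0l (gl _)) scale0r.
rewrite (gC _ _ 0) (bil0l (gl _)) scale0r subr0 addr0.
exact: (nor_part0 si immersion gL timelike).
Qed.

(** The term with the derivative of [f] is a multiple of [Y p], whose normal part is zero. *)
Lemma nor_part_leibniz p v f Y : smooth_fun f -> smooth_along i Y ->
  nor_part i g p (Y p) = 0 ->
  nor_part i g p (D p v (fun q => f q *: Y q)) =
  f p *: nor_part i g p (D p v Y).
Proof.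
move=> sf sY Y0; rewrite (connection_leibniz Dconn) // nor_partD !nor_partZ Y0.
by rewrite scaler0 add0r.
Qed.

Lemma nor_part_connection_xi p v : nor_part i g p (D p v (xi \o i)) = 0.
Proof. by rewrite connection_xi nor_partZ nor_part_phi scaler0. Qed.

(** Defining this field by [tan_part] makes its smoothness an instance of [smooth_tan_part];
    invariance ensures that [i] maps it to [xi]. *)
Definition xi_tan p : 'rV[R]_m := tan_part i g p (xi (i p)).

Lemma push_xi_tan : push i xi_tan = xi \o i.
Proof. by apply/funext => p; exact/tmap_tan_part/hinv.1. Qed.

Lemma smooth_xi_tan : smooth_vf xi_tan.
Proof.
exact: (smooth_tan_part si immersion gL timelike smooth_along_xi).
Qed.

Lemma sff_xi Y p : sff i g D Y xi_tan p = 0.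
Proof.
by rewrite /sff push_xi_tan nor_part_connection_xi.
Qed.

(** The Levi-Civita term gives [alpha] times phi X, [eta xi = - 1] subtracts phi X, and the last
    term drops since phi X is orthogonal to [xi]. The result is tangent by invariance. *)
Lemma push_qs_tan_xi X p : push i (qs_tan i g xi D X xi_tan) p =
  (alpha (i p) + - 1) *: phi g xi (i p) (push i X p).
Proof.
set w := phi g xi (i p) (push i X p).
have [u uw] := hinv.2 p (X p); rewrite -/(push i X p) -/w in uw.
have ew : eta g xi (i p) (xi (i p)) = - 1 by exact: lcs_xi_unit hN _.
have gw : g (i p) w (xi (i p)) = 0.
  rewrite /w /phi (bilDl (gl _)) (bilZl (gl _)) (lcs_xi_unit hN) /eta.
  by rewrite mulrN1 subrr.
have e : quarter_symmetric i g xi D p (X p) (push i xi_tan) =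
    tmap i p ((alpha (i p) + - 1) *: u).
  rewrite /quarter_symmetric push_xi_tan connection_xi /= ew.
  rewrite -/(push i X p) -/w gw scale0r subr0 -scalerDl -uw.
  rewrite -[_ *: u]addr0 (tmap_linear si) (tmap0 si).
  by rewrite addr0.
rewrite /qs_tan /push e (tan_part_tmap si immersion gL timelike) -uw.
by rewrite -[_ *: u]addr0 (tmap_linear si) (tmap0 si) addr0.
Qed.

(* sigma(X, phi Y) = sigma(X, Y), and sigma is linear over functions in its
   second argument. *)
Lemma sff_qs_tan_xi X Y p : smooth_vf X -> smooth_vf Y ->
  sff i g D Y (qs_tan i g xi D X xi_tan) p =
  (alpha (i p) + - 1) *: sff i g D Y X p.
Proof.
move=> sX sY; have spX := smooth_push sX; have sphi := smooth_phi spX.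
have sa : smooth_fun (fun p => alpha (i p) + - 1).
  apply: smooth_funD (smooth_fun_comp si (lcs_alpha_smooth hN)) _.
  exact: smooth_fun_cst.
rewrite {1}/sff.
rewrite (_ : push i _ = fun q => (alpha (i q) + - 1) *:
    phi g xi (i q) (push i X q)); last first.
  by apply/funext => q; exact: push_qs_tan_xi.
have phi0 : nor_part i g p (phi g xi (i p) (push i X p)) = 0.
  exact: nor_part_phi.
(* Expand phi X as X + eta(X) xi: the second summand contributes eta(X) sigma(Y, xi), which is
   zero. *)
have sphiE : nor_part i g p (D p (Y p) (fun q => phi g xi (i q) (push i X q))) =
    sff i g D Y X p.
  rewrite (connection_add Dconn _ _ spX (smooth_eta_xi spX)) nor_partD.
  rewrite (nor_part_leibniz _ (smooth_eta spX) smooth_along_xi (nor_part_xi p)).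
  by rewrite nor_part_connection_xi scaler0 addr0.
by rewrite -sphiE; exact: nor_part_leibniz sa sphi phi0.
Qed.

End InvariantSubmanifold.

Theorem theorem5p1 (R : realType) (m n : nat) (hmn : (m < n)%N)
    (M : manifold R m) (N : manifold R n)
    (g : N -> 'rV[R]_n -> 'rV[R]_n -> R)
    (nabla : N -> 'rV[R]_n -> (N -> 'rV[R]_n) -> 'rV[R]_n)
    (xi : N -> 'rV[R]_n) (alpha : N -> R)
    (hN : lcs_manifold g xi nabla alpha)
    (i : M -> N) (hi : submanifold i) (hinv : invariant_submanifold i g xi)
    (D : M -> 'rV[R]_m -> (M -> 'rV[R]_n) -> 'rV[R]_n)
    (hD : induced_connection i nabla D)
    (halpha : forall p : N, alpha p != 1) :
  qs_recurrent i g xi D <-> totally_geodesic i g D.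
Proof.
split=> [[w [_ wrec]] Y X sY sX p|tg].
  have := wrec X Y _ sX sY (smooth_xi_tan hN hi hinv) p.
  have sxi Z : sff i g D Z (xi_tan g xi i) = fun=> 0.
    by apply/funext => q; exact: (sff_xi hN hi hinv hD).
  (* Every term of the recurrence equation except sigma(Y, nabla-bar_X xi) has a factor or an
     argument of the form sigma(_, xi), so it vanishes. *)
  rewrite /qs_dsff !sxi (qs_perp0 hN hi hinv hD).
  rewrite (sff_qs_tan_xi hN hi hinv hD) //.
  move=> /eqP; rewrite scaler0 !sub0r oppr0 add0r oppr_eq0 scaler_eq0.
  by rewrite subr_eq0 (negbTE (halpha _)) => /eqP.
(* When sigma is zero both sides of the recurrence equation vanish, so the zero form serves. *)
exists (fun _ _ => 0); split.
  split=> [p a u v|c j ac k]; first by rewrite mulr0 addr0.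
  exact: class_C_cst.
move=> X Y Z sX sY sZ p; rewrite scale0r /qs_dsff.
rewrite (_ : sff i g D Y Z = fun=> 0); last by apply/funext => q; exact: tg.
(* Total geodesy covers smooth fields only, so nabla-bar_X Y and nabla-bar_X Z must be smooth before
   it applies to them. *)
have sYX := smooth_qs_tan hN hi hinv hD.
have sub3 (a b c : 'rV[R]_n) : a = 0 -> b = 0 -> c = 0 -> a - b - c = 0.
  by move=> -> -> ->; rewrite !subr0.
apply: sub3; first exact: (qs_perp0 hN hi hinv hD).
- exact: (tg _ _ (sYX _ _ sX sY) sZ p).
- exact: (tg _ _ sY (sYX _ _ sX sZ) p).
Qed.
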